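(* For all formulas $\alpha,\beta\in\tilde F$: 1. $\alpha\vDash_{\mathfrak{F}_3}\beta\Leftrightarrow\alpha\vdash_{K_{im}}\beta$, and 2. $\alpha\vDash_{\mathfrak{F}_3'}\beta\Leftrightarrow\alpha\vdash_{K_{im-\vee}}\beta$, where $\mathfrak{F}_3$ is the class of sub-compatibility frames and $\mathfrak{F}_3'$ the class of sub-compatibility identity frames.
   Context: $\tilde F$ is the set of formulas built from propositional variables and constants $\top,\bot$ with $\wedge,\vee,\neg,\sim$. $K_{im}$ is the sequent logic (sequents are pairs $\alpha\vdash\beta$ of formulas) with axioms and rules (premises / conclusion): A1 $\alpha\vdash\alpha$; A2 $\alpha\vdash\beta,\ \beta\vdash\gamma$ / $\alpha\vdash\gamma$; A3 $\alpha\wedge\beta\vdash\alpha$, $\alpha\wedge\beta\vdash\beta$; A4 $\alpha\vdash\beta,\ \alpha\vdash\gamma$ / $\alpha\vdash\beta\wedge\gamma$; A5 $\alpha\vdash\gamma,\ \beta\vdash\gamma$ / $\alpha\vee\beta\vdash\gamma$; A6 $\alpha\vdash\alpha\vee\beta$, $\beta\vdash\alpha\vee\beta$; A7 $\alpha\wedge(\beta\vee\gamma)\vdash(\alpha\wedge\beta)\vee(\alpha\wedge\gamma)$; A8 $\alpha\vdash\top$; A9 $\bot\vdash\alpha$; A10 $\alpha\vdash\beta$ / $\neg\beta\vdash\neg\alpha$; A11 $\neg\alpha\wedge\neg\beta\vdash\neg(\alpha\vee\beta)$; A12 $\top\vdash\neg\bot$; A13 $\alpha\vdash\neg\neg\alpha$;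 A14 $\alpha\wedge\beta\vdash\gamma$ / $\alpha\wedge\neg\gamma\vdash\neg\beta$; A15 $\alpha\wedge\neg\alpha\vdash\beta$; A16 $\sim\alpha\vdash\neg(\alpha\wedge\neg\sim\top)$; A17 $\neg(\alpha\wedge\neg\sim\top)\vdash\sim\alpha$. $K_{im-\vee}$ adds A18 $\top\vdash\alpha\vee\sim\alpha$. $\alpha\vdash_{K}\beta$ means the sequent is derivable in $K$. A compatibility frame is $(W,C,\leq)$ with $(W,\leq)$ a poset and $C$ a binary relation on $W$ such that $x'\leq x$, $y'\leq y$ and $xCy$ imply $x'Cy'$. A sub-compatibility frame is a compatibility frame such that (1) $C$ is symmetric; (2) $\forall x,y\,(xCy\Rightarrow\exists z(x\leq z\ \&\ y\leq z\ \&\ xCz))$; (3) for all $x$: if for every $y\geq x$ there is $z\geq y$ with no $z'$ satisfying $zCz'$, then there is no $z''$ with $xCz''$. A sub-compatibility identity frame is a sub-compatibility frame with $C\subseteq(\leq^{-1})$, i.e. $xCy$ implies $y\leq x$. A valuation assigns an upset of $W$ to each propositional variable. Truth: variables via the valuation; $\top$ everywhere, $\bot$ nowhere; $\wedge,\vee$ pointwise; $x\vDash\neg\alpha$ iff for all $y\geq x$, $y\nvDash\alpha$; $x\vDash\sim\alpha$ iff for all $y$, $xCy$ implies $y\nvDash\alpha$. For a class $\mathfrak{F}$ of frames, $\alpha\vDash_{\mathfrak{F}}\beta$ means: for every frame in $\mathfrak{F}$, every valuation on it and every point $x$, $x\vDash\alpha$ implies $x\vDash\beta$. *)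

(* Defs.v *)
From Stdlib Require Import Relation_Definitions.

Set Implicit Arguments.
Unset Strict Implicit.

Inductive form (Var : Type) : Type :=
| fvar (p : Var)
| ftop
| fbot
| fwedge (a b : form Var)
| fvee (a b : form Var)
| fneg (a : form Var)   (* the negation written \neg *)
| fsim (a : form Var).  (* the negation written \sim *)

Arguments ftop {Var}.
Arguments fbot {Var}.

(* Derivability of the sequent [a |- b] in the logic K_im extended with the
   sequents of [Ax] as additional axioms. *)
Inductive derives (Var : Type) (Ax : form Var -> form Var -> Prop) :
    form Var -> form Var -> Prop :=
| A1 a : derives Ax a a
| A2 a b c : derives Ax a b -> derives Ax b c -> derives Ax a c
| A3l a b : derives Ax (fwedge a b) a
| A3r a b : derives Ax (fwedge a b) b
| A4 a b c : derives Ax a b -> derives Ax a c -> derives Ax a (fwedge b c)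
| A5 a b c : derives Ax a c -> derives Ax b c -> derives Ax (fvee a b) c
| A6l a b : derives Ax a (fvee a b)
| A6r a b : derives Ax b (fvee a b)
| A7 a b c :
    derives Ax (fwedge a (fvee b c)) (fvee (fwedge a b) (fwedge a c))
| A8 a : derives Ax a ftop
| A9 a : derives Ax fbot a
| A10 a b : derives Ax a b -> derives Ax (fneg b) (fneg a)
| A11 a b : derives Ax (fwedge (fneg a) (fneg b)) (fneg (fvee a b))
| A12 : derives Ax ftop (fneg fbot)
| A13 a : derives Ax a (fneg (fneg a))
| A14 a b c :
    derives Ax (fwedge a b) c -> derives Ax (fwedge a (fneg c)) (fneg b)
| A15 a b : derives Ax (fwedge a (fneg a)) b
| A16 a : derives Ax (fsim a) (fneg (fwedge a (fneg (fsim ftop))))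
| A17 a : derives Ax (fneg (fwedge a (fneg (fsim ftop)))) (fsim a)
| AExtra a b : Ax a b -> derives Ax a b.

Inductive no_axiom (Var : Type) : form Var -> form Var -> Prop := .

Inductive sim_excluded_middle (Var : Type) : form Var -> form Var -> Prop :=
| A18 a : sim_excluded_middle ftop (fvee a (fsim a)).

Definition K_im (Var : Type) : form Var -> form Var -> Prop :=
  derives (@no_axiom Var).

Definition K_im_vee (Var : Type) : form Var -> form Var -> Prop :=
  derives (@sim_excluded_middle Var).

Record compat_frame : Type := CompatFrame {
  world :> Type;
  compat : relation world;
  fle : relation world;
  fle_order : order world fle;
  compat_down : forall x y x' y' : world,
    fle x' x -> fle y' y -> compat x y -> compat x' y'
}.

Definition sub_compat_frame (W : compat_frame) : Prop :=
  symmetric W (@compat W) /\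
  (forall x y : W, compat x y ->
     exists z : W, fle x z /\ fle y z /\ compat x z) /\
  (forall x : W,
     (forall y : W, fle x y ->
        exists z : W, fle y z /\ ~ (exists z' : W, compat z z')) ->
     ~ (exists z'' : W, compat x z'')).

Definition sub_compat_identity_frame (W : compat_frame) : Prop :=
  sub_compat_frame W /\ (forall x y : W, compat x y -> fle y x).

Definition upset (W : compat_frame) (U : W -> Prop) : Prop :=
  forall x y : W, fle x y -> U x -> U y.

Record valuation (Var : Type) (W : compat_frame) : Type := Valuation {
  val_set :> Var -> W -> Prop;
  val_upset : forall p : Var, upset (val_set p)
}.

Fixpoint truth (Var : Type) (W : compat_frame) (v : valuation Var W)
    (x : W) (a : form Var) {struct a} : Prop :=
  match a with
  | fvar p => v p x
  | ftop => True
  | fbot => False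
  | fwedge b c => truth v x b /\ truth v x c
  | fvee b c => truth v x b \/ truth v x c
  | fneg b => forall y : W, fle x y -> ~ truth v y b
  | fsim b => forall y : W, compat x y -> ~ truth v y b
  end.

Definition entails (Var : Type) (F : compat_frame -> Prop) (a b : form Var) :
    Prop :=
  forall W : compat_frame, F W ->
  forall (v : valuation Var W) (x : W), truth v x a -> truth v x b.

(* Main.v *)
From mathcomp Require Import ssreflect ssrfun ssrbool.
From mathcomp Require Import boolp classical_sets.
Require Import Defs.

(** Soundness is a direct check: condition (2) of a sub-compatibility frame
    gives A16, and symmetry with (2) and (3) gives A17.
    For completeness, the points of the canonical frame are the prime theories
    ordered by inclusion, with [P C Q] iff [~a \in P] excludes [a \in Q].  By
    A16 and A17, [~a] is interderivable with [\neg (a /\ \neg ~T)], so every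
    property of [~] needed below reduces to one of [\neg].  All witnesses come
    from the prime filter theorem, usually applied to the ideal
    [{a | ~a \in P}]. *)

Set Implicit Arguments.
Unset Strict Implicit.

Local Open Scope classical_set_scope.

(** * Persistence of truth and soundness *)

Lemma truth_le (Var : Type) (W : compat_frame) (v : valuation Var W)
    (a : form Var) (x y : W) :
  fle x y -> truth v x a -> truth v y a.
Proof.
have [le_refl le_trans _] := fle_order W.
elim: a x y => [p|||a IHa b IHb|a IHa b IHb|a _|a _] x y le_xy //=.
- exact: val_upset le_xy.
- by case=> xa xb; split; [apply: IHa xa | apply: IHb xb].
- by case=> [xa|xb]; [left; apply: IHa xa | right; apply: IHb xb].
- by move=> xNa z le_yz; apply: xNa; apply: le_trans le_yz.
- by move=> xSa z yCz; apply: xSa; apply: compat_down le_xy (le_refl z) yCz.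
Qed.

Lemma derives_sound (Var : Type) (Ax : form Var -> form Var -> Prop)
    (W : compat_frame) (v : valuation Var W) :
  sub_compat_frame W ->
  (forall a b, Ax a b -> forall x, truth v x a -> truth v x b) ->
  forall a b, derives Ax a b -> forall x, truth v x a -> truth v x b.
Proof.
move=> [symC [joinC deadC]] soundAx a b.
have [le_refl le_trans _] := fle_order W.
elim=> {a b} /=.
- by [].
- by move=> a b c _ ab _ bc x /ab/bc.
- by move=> a b x [].
- by move=> a b x [].
- by move=> a b c _ ab _ ac x xa; split; [apply: ab | apply: ac].
- by move=> a b c _ ac _ bc x [/ac|/bc].
- by move=> a b x; left.
- by move=> a b x; right.
- by move=> a b c x [xa [xb|xc]]; [left | right].
- by [].
- by [].
- by move=> a b _ ab x xNb y le_xy /ab; apply: xNb.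
- by move=> a b x [xNa xNb] y le_xy [/(xNa y le_xy)|/(xNb y le_xy)].
- by move=> x _ y _.
- move=> a x xa y le_xy yNa; apply: (yNa y (le_refl y)).
  exact: truth_le le_xy xa.
- move=> a b c _ abc x [xa xNc] y le_xy yb; apply: (xNc y le_xy).
  by apply: abc; split => //; apply: truth_le le_xy xa.
- by move=> a b x [xa xNa]; case: (xNa x (le_refl x)).
(* A16: [y] has no successor [z], since (2) would turn it into a successor [w] above [y], where [a]
   persists although [x] is compatible with [w]. So [fsim ftop] holds at [y], against [yN]. *)
- move=> a x xSa y le_xy [ya yN]; apply: (yN y (le_refl y)) => z yCz _.
  have [w [le_yw [_ yCw]]] := joinC _ _ yCz.
  apply: (xSa w); last exact: truth_le le_yw ya.
  exact: compat_down le_xy (le_refl w) yCw.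
(* A17: let [z] be the upper bound of [x] and [y] from (2). Every [w] above [z] verifies [a], so
   [xN] yields some [u] above [w] that verifies [fsim ftop], that is, has no successor. By (3) [z]
   has none either, but symmetry makes [x] one. *)
- move=> a x xN y xCy ya.
  have [z [le_xz [le_yz xCz]]] := joinC _ _ xCy.
  apply: (deadC z); last by exists x; apply: symC.
  move=> w le_zw; apply: contrapT => noz.
  apply: (xN w (le_trans _ _ _ le_xz le_zw)); split.
    exact: truth_le (le_trans _ _ _ le_yz le_zw) ya.
  move=> u le_wu uS; apply: noz; exists u; split=> // -[u' uCu'].
  exact: (uS u').
- exact: soundAx.
Qed.

Lemma sim_excluded_middle_sound (Var : Type) (W : compat_frame)
    (v : valuation Var W) :
  (forall x y : W, compat x y -> fle y x) ->
  forall a b, sim_excluded_middle a b ->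
  forall x, truth v x a -> truth v x b.
Proof.
move=> leC _ _ [a] x _ /=; have [xa|xNa] := EM (truth v x a); first by left.
by right=> y /leC le_yx ya; apply: xNa; apply: truth_le le_yx ya.
Qed.

(** * Derived sequents for [fsim] *)

Lemma wedge_derives (Var : Type) (Ax : form Var -> form Var -> Prop)
    (a b c d : form Var) :
  derives Ax a c -> derives Ax b d ->
  derives Ax (fwedge a b) (fwedge c d).
Proof.
by move=> ac bd; apply: A4; [apply: A2 (A3l _ _ _) ac | apply: A2 (A3r _ _ _) bd].
Qed.

Lemma vee_wedge_derives (Var : Type) (Ax : form Var -> form Var -> Prop)
    (p a b c d : form Var) :
  derives Ax (fwedge p a) c -> derives Ax (fwedge p b) d ->
  derives Ax (fwedge p (fvee a b)) (fvee c d).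
Proof.
move=> pac pbd; apply: A2 (A7 _ _ _ _) _.
by apply: A5; [apply: A2 pac (A6l _ _ _) | apply: A2 pbd (A6r _ _ _)].
Qed.

Lemma wedgeC_derives (Var : Type) (Ax : form Var -> form Var -> Prop)
    (a b : form Var) : derives Ax (fwedge a b) (fwedge b a).
Proof. by apply: A4; [apply: A3r | apply: A3l]. Qed.

Lemma sim_antitone (Var : Type) (Ax : form Var -> form Var -> Prop)
    (a b : form Var) : derives Ax a b -> derives Ax (fsim b) (fsim a).
Proof.
move=> ab; apply: A2 (A16 _ _) _; apply: A2 _ (A17 _ _).
by apply: A10; apply: wedge_derives => //; apply: A1.
Qed.

Lemma sim_vee (Var : Type) (Ax : form Var -> form Var -> Prop)
    (a b : form Var) :
  derives Ax (fwedge (fsim a) (fsim b)) (fsim (fvee a b)).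
Proof.
apply: A2 (wedge_derives (A16 _ _) (A16 _ _)) _.
apply: A2 (A11 _ _ _) _; apply: A2 _ (A17 _ _); apply: A10.
apply: A2 (wedgeC_derives _ _ _) _.
by apply: vee_wedge_derives; apply: wedgeC_derives.
Qed.

Lemma sim_bot (Var : Type) (Ax : form Var -> form Var -> Prop) :
  derives Ax ftop (fsim fbot).
Proof. by apply: A2 (A12 _) _; apply: A2 _ (A17 _ _); apply: A10; apply: A3l. Qed.

(** The counterpart of A14 for [fsim], needed for condition (2) in the canonical frame. *)
Lemma sim_wedge (Var : Type) (Ax : form Var -> form Var -> Prop)
    (p q a : form Var) :
  derives Ax (fwedge p q) a ->
  derives Ax (fwedge p (fsim a)) (fsim q).
Proof.
move=> pqa; apply: A2 (wedge_derives (A1 _ _) (A16 _ _)) _.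
apply: A2 _ (A17 _ _); apply: A14; apply: A4.
  apply: A2 _ pqa; apply: wedge_derives; [exact: A1 | exact: A3l].
by apply: A2 (A3r _ _ _) (A3r _ _ _).
Qed.

(** This makes canonical compatibility symmetric. By A16, [fsim a] contradicts [fwedge a n]; A14
    then moves [fwedge (fsim a) n] under a negation, which A17 reads as the outer [fsim]. *)
Lemma sim_sim (Var : Type) (Ax : form Var -> form Var -> Prop)
    (a : form Var) : derives Ax a (fsim (fsim a)).
Proof.
set n : form Var := fneg (fsim ftop).
have contra : derives Ax (fwedge a (fwedge (fsim a) n)) fbot.
  apply: (A2 _ (A15 Ax (fwedge a n) fbot)); apply: A4.
    by apply: wedge_derives; [apply: A1 | apply: A3r].
  by apply: A2 (A3r _ _ _) _; apply: A2 (A3l _ _ _) (A16 _ _).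
apply: A2 _ (A17 _ _); apply: A2 _ (A14 contra); apply: A4; first exact: A1.
exact: A2 (A8 _ _) (A12 _).
Qed.

(** * Filters, ideals and the prime filter theorem *)

Definition theory_filter (Var : Type) (Ax : form Var -> form Var -> Prop)
    (P : set (form Var)) : Prop :=
  [/\ P ftop, forall a b, P a -> P b -> P (fwedge a b)
    & forall a b, derives Ax a b -> P a -> P b].

Definition theory_ideal (Var : Type) (Ax : form Var -> form Var -> Prop)
    (I : set (form Var)) : Prop :=
  [/\ I fbot, forall a b, I a -> I b -> I (fvee a b)
    & forall a b, derives Ax a b -> I b -> I a].

Definition prime_theory (Var : Type) (Ax : form Var -> form Var -> Prop)
    (P : set (form Var)) : Prop :=
  [/\ theory_filter Ax P, ~ P fbot
    & forall a b, P (fvee a b) -> P a \/ P b].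

Definition up (Var : Type) (Ax : form Var -> form Var -> Prop)
    (a : form Var) : set (form Var) := [set c | derives Ax a c].

(** For filters [P] and [Q], this is the least filter containing both. *)
Definition filter_join (Var : Type) (Ax : form Var -> form Var -> Prop)
    (P Q : set (form Var)) : set (form Var) :=
  [set c | exists p q, [/\ P p, Q q & derives Ax (fwedge p q) c]].

Lemma up_filter (Var : Type) (Ax : form Var -> form Var -> Prop)
    (a : form Var) : theory_filter Ax (up Ax a).
Proof.
split; [exact: A8 | by move=> b c; apply: A4 | by move=> b c bc ab; apply: A2 bc].
Qed.

Lemma filter_join_filter (Var : Type) (Ax : form Var -> form Var -> Prop)
    (P Q : set (form Var)) :
  theory_filter Ax P -> theory_filter Ax Q ->
  theory_filter Ax (filter_join Ax P Q).
Proof.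
move=> [Ptop Pand _] [Qtop Qand _]; split.
- by exists ftop, ftop; split=> //; apply: A8.
- move=> a b [p [q [Pp Qq pqa]]] [p' [q' [Pp' Qq' pqb]]].
  exists (fwedge p p'), (fwedge q q'); split; [exact: Pand | exact: Qand |].
  by apply: A4; [apply: A2 _ pqa | apply: A2 _ pqb]; apply: wedge_derives;
    (apply: A3l || apply: A3r).
- move=> a b ab [p [q [Pp Qq pqa]]]; exists p, q; split=> //.
  exact: A2 pqa ab.
Qed.

Lemma sub_filter_joinl (Var : Type) (Ax : form Var -> form Var -> Prop)
    (P Q : set (form Var)) : theory_filter Ax Q -> P `<=` filter_join Ax P Q.
Proof. by move=> [Qtop _ _] a Pa; exists a, ftop; split=> //; apply: A3l. Qed.

Lemma sub_filter_joinr (Var : Type) (Ax : form Var -> form Var -> Prop)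
    (P Q : set (form Var)) : theory_filter Ax P -> Q `<=` filter_join Ax P Q.
Proof. by move=> [Ptop _ _] a Qa; exists ftop, a; split=> //; apply: A3r. Qed.

(** Zorn's lemma gives a maximal filter that contains [F] and avoids [I]; distributivity makes it
    prime. *)
Lemma prime_filter_theorem (Var : Type) (Ax : form Var -> form Var -> Prop)
    (F I : set (form Var)) :
  theory_filter Ax F -> theory_ideal Ax I -> (forall a, F a -> ~ I a) ->
  exists P, [/\ prime_theory Ax P, F `<=` P & forall a, P a -> ~ I a].
Proof.
move=> filF [Ibot Ivee Ider] disjF; have [Ftop Fand Fder] := filF.
(* The third condition lets the empty set in, as the union of the empty chain. *)
pose good (X : set (form Var)) :=
  [/\ forall a b, X a -> X b -> X (fwedge a b),
      forall a b, derives Ax a b -> X a -> X b,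
      forall a, X a -> F `<=` X & forall a, X a -> ~ I a].
have [S goodS totS|M [[Mand Mder MF MI] maxM]] := @Zorn_bigcup _ good.
  split.
  - move=> a b [X SX Xa] [Y SY Yb].
    have [XY|YX] := totS _ _ SX SY.
      by exists Y => //; have [Yand _ _ _] := goodS _ SY; apply: Yand; first apply: XY.
    by exists X => //; have [Xand _ _ _] := goodS _ SX; apply: Xand; last apply: YX.
  - move=> a b ab [X SX Xa]; exists X => //.
    by have [_ Xder _ _] := goodS _ SX; apply: Xder Xa.
  - move=> a [X SX Xa] c Fc; exists X => //.
    by have [_ _ XF _] := goodS _ SX; apply: XF Xa _ Fc.
  - by move=> a [X SX Xa]; have [_ _ _ XI] := goodS _ SX; apply: XI.
have goodP X : theory_filter Ax X -> F `<=` X -> (forall a, X a -> ~ I a) -> good X.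
  by move=> [Xtop Xand Xder] FX XI; split.
(* Otherwise [M] is empty and [F] is a larger good set. *)
have FM : F `<=` M.
  apply: contrapT => FNM; apply: (maxM F); last exact: goodP.
  by split=> // a Ma; case: FNM; apply: MF Ma.
have filM : theory_filter Ax M by split=> //; apply: FM.
exists M; split=> //; split=> //; first by move=> /MI/(_ Ibot).
(* Otherwise the filter generated by [M] and [a] would be a larger good set. *)
have extend a : ~ M a -> exists p c, [/\ M p, I c & derives Ax (fwedge p a) c].
  move=> MNa; apply: contrapT => noext; have fila := up_filter Ax a.
  apply: (maxM (filter_join Ax M (up Ax a))).
    split; first exact: sub_filter_joinl.
    move=> sub; apply: MNa; apply: sub.
    by apply: sub_filter_joinr => //; apply: A1.
  apply: goodP; first exact: filter_join_filter.
    by move=> c /FM; apply: sub_filter_joinl.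
  move=> c [p [q [Mp aq pqc]]] Ic; apply: noext; exists p, c; split=> //.
  by apply: A2 pqc; apply: wedge_derives => //; apply: A1.
move=> a b Mab; apply: contrapT => /not_orP[MNa MNb].
have [p [c [Mp Ic pac]]] := extend _ MNa.
have [q [d [Mq Id qbd]]] := extend _ MNb.
(* By A7, [p], [q] and [fvee a b] together derive [fvee c d], so [M] would meet [I]. *)
apply: (MI (fvee c d)); last exact: Ivee.
apply: Mder (Mand _ _ (Mand _ _ Mp Mq) Mab); apply: vee_wedge_derives.
  by apply: A2 _ pac; apply: wedge_derives; [apply: A3l | apply: A1].
by apply: A2 _ qbd; apply: wedge_derives; [apply: A3r | apply: A1].
Qed.

Lemma down_ideal (Var : Type) (Ax : form Var -> form Var -> Prop)
    (b : form Var) : theory_ideal Ax [set a | derives Ax a b].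
Proof.
by split; [apply: A9 | move=> c d; apply: A5 | move=> c d cd db; apply: A2 db].
Qed.

(** The successors of a prime theory [P] in the canonical frame are exactly the prime theories
    disjoint from this ideal. *)
Lemma sim_ideal (Var : Type) (Ax : form Var -> form Var -> Prop)
    (P : set (form Var)) :
  theory_filter Ax P -> theory_ideal Ax [set a | P (fsim a)].
Proof.
move=> [Ptop Pand Pder]; split.
- exact: Pder (sim_bot Ax) Ptop.
- by move=> a b Pa Pb; apply: Pder (sim_vee _ _ _) (Pand _ _ Pa Pb).
- by move=> a b /sim_antitone; apply: Pder.
Qed.

(** * The canonical frame *)

Definition prime_point (Var : Type) (Ax : form Var -> form Var -> Prop) : Type :=
  {P : set (form Var) | prime_theory Ax P}.

Definition canonical_le (Var : Type) (Ax : form Var -> form Var -> Prop)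
    (P Q : prime_point Ax) : Prop := sval P `<=` sval Q.

Definition canonical_compat (Var : Type) (Ax : form Var -> form Var -> Prop)
    (P Q : prime_point Ax) : Prop :=
  forall a, sval P (fsim a) -> ~ sval Q a.

Lemma canonical_le_order (Var : Type) (Ax : form Var -> form Var -> Prop) :
  Relation_Definitions.order _ (@canonical_le Var Ax).
Proof.
split.
- by move=> P.
- by move=> P Q R PQ QR a /PQ/QR.
- move=> [P primeP] [Q primeQ] PQ QP; apply: eq_exist.
  by rewrite eqEsubset; split.
Qed.

Lemma canonical_compat_down (Var : Type) (Ax : form Var -> form Var -> Prop)
    (P Q P' Q' : prime_point Ax) :
  canonical_le P' P -> canonical_le Q' Q ->
  canonical_compat P Q -> canonical_compat P' Q'.
Proof. by move=> P'P Q'Q PCQ a /P'P/PCQ Qa /Q'Q. Qed.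

Definition canonical_frame (Var : Type) (Ax : form Var -> form Var -> Prop) :
    compat_frame :=
  CompatFrame (canonical_le_order Ax) (@canonical_compat_down Var Ax).

Lemma canonical_neg (Var : Type) (Ax : form Var -> form Var -> Prop)
    (P : prime_point Ax) (a : form Var) :
  sval P (fneg a) <-> forall Q, canonical_le P Q -> ~ sval Q a.
Proof.
case: P => P primeP /=; have [filP _ _] := primeP; have [Ptop Pand Pder] := filP.
split=> [PNa Q PQ Qa|PNQ].
  have [[_ Qand Qder] QNbot _] := svalP Q.
  by apply/QNbot/(Qder _ _ (A15 _ a _)); apply: Qand => //; apply: PQ.
apply: contrapT => PNNa; have fila := up_filter Ax a.
have [c [p [q [Pp aq pqc]]] cbot|Q [primeQ joinQ _]] :=
  prime_filter_theorem (filter_join_filter filP fila) (down_ideal Ax fbot).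
  (* If [p] and [a] derive [fbot], then A14 derives [fneg a] from [p] and [fneg fbot], and the
     latter is in [P] by A12. *)
  apply: PNNa; apply: (Pder (fwedge p (fneg fbot))).
    apply: A14; apply: A2 cbot; apply: A2 pqc.
    by apply: wedge_derives => //; apply: A1.
  by apply: Pand => //; apply: Pder (A12 _) Ptop.
apply: (PNQ (exist _ Q primeQ)) => /= [b Pb|]; apply: joinQ.
  exact: sub_filter_joinl.
by apply: sub_filter_joinr => //; apply: A1.
Qed.

Lemma canonical_sim (Var : Type) (Ax : form Var -> form Var -> Prop)
    (P : prime_point Ax) (a : form Var) :
  sval P (fsim a) <-> forall Q, canonical_compat P Q -> ~ sval Q a.
Proof.
split=> [PSa Q|]; first exact.
case: P => P primeP; have [filP _ _] := primeP; have [_ _ Pder] := filP.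
move=> PNQ /=; apply: contrapT => PNSa.
(* The filter of [a] avoids the ideal: if [a] derives [b] with [fsim b] in [P], antitonicity puts
   [fsim a] in [P]. The resulting [Q] is a successor of [P] containing [a]. *)
have [b ab PSb|Q [primeQ aQ QP]] :=
  prime_filter_theorem (up_filter Ax a) (sim_ideal filP).
  by apply: PNSa; apply: Pder (sim_antitone ab) PSb.
apply: (PNQ (exist _ Q primeQ)) => [b /= PSb /QP|]; first exact.
by apply: aQ; apply: A1.
Qed.

Lemma canonical_sub_compat (Var : Type) (Ax : form Var -> form Var -> Prop) :
  sub_compat_frame (canonical_frame Ax).
Proof.
split; [|split].
- move=> P Q PCQ a QSa Pa; have [[_ _ Pder] _ _] := svalP P.
  exact: PCQ (Pder _ _ (sim_sim _ _) Pa) QSa.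
- move=> [P primeP] [Q primeQ] /= PCQ.
  have [filP _ _] := primeP; have [filQ _ _] := primeQ.
  have [_ Pand Pder] := filP.
  (* The bound [R] must extend [P] and [Q] and avoid the ideal of [P]. A clash at [a] would put
     [fsim q] in [P] for some [q] in [Q], against [PCQ]. *)
  have [a [p [q [Pp Qq pqa]]] PSa|R [primeR joinR RP]] :=
    prime_filter_theorem (filter_join_filter filP filQ) (sim_ideal filP).
    apply: (PCQ q) => //=.
    exact: Pder (sim_wedge pqa) (Pand _ _ Pp PSa).
  exists (exist _ R primeR); split=> [a Pa|]; [|split=> [a Qa|a PSa /RP]] => /=.
  + by apply: joinR; apply: sub_filter_joinl.
  + by apply: joinR; apply: sub_filter_joinr.
  + exact.
(* Condition (3): it suffices to find [fsim ftop] in [P], and by A17 its double [fneg] is enough. No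
   [R] above [P] contains [fneg (fsim ftop)], because the successorless [T] above [R] contains
   [fsim ftop]. *)
- move=> P /= deadP [Q PCQ]; have [filQ _ _] := svalP Q.
  have [Qtop _ _] := filQ; apply: PCQ Qtop.
  have [[_ _ Pder] _ _] := svalP P.
  apply: (Pder _ _ (A17 _ _)); apply: (Pder _ _ (A10 (A3r _ _ _))).
  apply/canonical_neg => R /deadP[T [RT deadT]] /canonical_neg RN.
  apply: RN RT _; apply/canonical_sim => U TCU _.
  by apply: deadT; exists U.
Qed.

(** If [a] is in a successor of [P], then [fsim a] is not in [P], so primeness and excluded middle
    put [a] in [P]. *)
Lemma canonical_compat_identity (Var : Type)
    (Ax : form Var -> form Var -> Prop) :
  (forall a, derives Ax ftop (fvee a (fsim a))) ->
  sub_compat_identity_frame (canonical_frame Ax).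
Proof.
move=> em; split; first exact: canonical_sub_compat.
move=> P Q /= PCQ a Qa; have [[Ptop _ Pder] _ Pprime] := svalP P.
have [//|PSa] := Pprime _ _ (Pder _ _ (em a) Ptop).
by case: (PCQ _ PSa).
Qed.

Definition canonical_valuation (Var : Type)
    (Ax : form Var -> form Var -> Prop) : valuation Var (canonical_frame Ax) :=
  @Valuation Var (canonical_frame Ax) (fun p P => sval P (fvar p))
    (fun p P Q (PQ : canonical_le P Q) => PQ (fvar p)).

(** * Truth lemma and completeness *)

Lemma canonical_truth (Var : Type) (Ax : form Var -> form Var -> Prop)
    (a : form Var) (P : canonical_frame Ax) :
  truth (canonical_valuation Ax) P a <-> sval P a.
Proof.
elim: a P => [p|||a IHa b IHb|a IHa b IHb|a IHa|a IHa] P //=;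
  have [[Ptop Pand Pder] PNbot Pprime] := svalP P.
- by split.
- by split.
- split=> [[/IHa Pa /IHb Pb]|Pab]; first exact: Pand.
  by split; [apply/IHa; apply: Pder Pab; apply: A3l
            | apply/IHb; apply: Pder Pab; apply: A3r].
- split=> [[/IHa|/IHb]|/Pprime[/IHa|/IHb]]; [| |by left|by right].
    by apply: Pder; apply: A6l.
  by apply: Pder; apply: A6r.
- split=> [PN|/canonical_neg PN Q PQ /IHa]; last exact: PN.
  by apply/canonical_neg => Q PQ /IHa; apply: PN.
- split=> [PS|/canonical_sim PS Q PCQ /IHa]; last exact: PS.
  by apply/canonical_sim => Q PCQ /IHa; apply: PS.
Qed.

(** If the sequent is not derivable, a prime theory containing [a] and omitting [b] refutes it in
    the canonical frame. *)
Lemma derives_complete (Var : Type) (Ax : form Var -> form Var -> Prop)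
    (F : compat_frame -> Prop) (a b : form Var) :
  F (canonical_frame Ax) -> entails F a b -> derives Ax a b.
Proof.
move=> FW ab; apply: contrapT => aNb.
have [c ac cb|P [primeP aP Pb]] :=
  prime_filter_theorem (up_filter Ax a) (down_ideal Ax b).
  by apply: aNb; apply: A2 cb.
pose x : canonical_frame Ax := exist _ P primeP.
apply: (Pb b); last exact: A1.
apply/(canonical_truth _ x)/ab/canonical_truth => //.
by apply: aP; apply: A1.
Qed.

Theorem theorem6p15 (Var : Type) (a b : form Var) :
  (entails sub_compat_frame a b <-> K_im a b) /\
  (entails sub_compat_identity_frame a b <-> K_im_vee a b).
Proof.
split; split.
- by apply: derives_complete; apply: canonical_sub_compat.
- by move=> ab W subW v; apply: derives_sound ab.
- apply: derives_complete; apply: canonical_compat_identity => c.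
  by apply: AExtra.
- move=> ab W [subW leW] v; apply: derives_sound ab => //.
  exact: sim_excluded_middle_sound.
Qed.
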